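(* Let $\mathcal{Q}(C)$ be a covering polyhedron and let $\mathcal{F}=\{I_n\}_{n=0}^\infty$ be its associated filtration. If $\mathcal{F}$ is strict, then $\widehat{\rho}(\mathcal{F})=\widehat{\rho}_{ic}(\mathcal{F})=\rho_{ic}(\mathcal{F})$ and this is a finite number.
   Context: $S=K[t_1,\ldots,t_s]$ is a polynomial ring over a field $K$, $\mathbb{N}=\{0,1,\ldots\}$, $t^a=t_1^{a_1}\cdots t_s^{a_s}$ for $a\in\mathbb{N}^s$; vector inequalities are componentwise and $1$ also denotes $(1,\ldots,1)$. A covering polyhedron is a polyhedron $\mathcal{Q}(C)=\{x\in\mathbb{R}^s\mid x\geq 0;\ xC\geq 1\}$ ($x$ a row vector), where $C$ is an $s\times m$ matrix with non-negative rational entries and non-zero columns. Its associated filtration is $I_0=S$ and, for $n\geq 1$, $I_n$ the ideal generated by all monomials $t^a$, $a\in\mathbb{N}^s$, with $a/n\in\mathcal{Q}(C)$. It is strict if $I_{n+1}\subsetneq I_n$ for all $n\geq 0$. $\overline{L}$ is the integral closure of an ideal $L$. With $m,r$ ranging over positive integers: the asymptotic resurgence of $\mathcal{F}$ is $\widehat{\rho}(\mathcal{F})=\sup\{m/r\mid I_{mt}\not\subset I_1^{rt}\text{ for all } t\gg 0\}$, the ic-asymptotic resurgence is $\widehat{\rho}_{ic}(\mathcal{F})=\sup\{m/r\mid I_{mt}\not\subset\overline{I_1^{rt}}\text{ for all } t\gg 0\}$, and the ic-resurgence is $\rho_{ic}(\mathcal{F})=\sup\{m/r\mid I_m\not\subset\overline{I_1^r}\}$.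 *)

(* Defs.v *)
From HB Require Import structures.
From mathcomp Require Import all_boot all_order all_algebra.
From mathcomp Require Import boolp classical_sets filter.
From mathcomp Require Import reals constructive_ereal ereal topology.
(* The notations of [mpoly] clash with those of mathcomp-analysis, so only its
   constants, coercions and instances are imported. *)
From mathcomp Require Import -(notations) mpoly.

Set Implicit Arguments.
Unset Strict Implicit.
Unset Printing Implicit Defensive.

Import Order.TTheory GRing.Theory Num.Theory.

Local Open Scope classical_set_scope.
Local Open Scope ring_scope.

(* Ideals are [set]s rather than instances of [idealr], since the latter are
   decidable and proper, whereas the unit ideal is needed here. *)
Section Ideals.
Variable A : comNzRingType.
Implicit Types (I J L G : set A) (F : nat -> set A).

Definition is_ideal I : Prop :=
  [/\ I 0, forall x y, I x -> I y -> I (x + y)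
         & forall a x, I x -> I (a * x)].

Definition ideal_gen G : set A := smallest is_ideal G.

Definition ideal_mul I J : set A := ideal_gen [set x * y | x in I & y in J].

Definition ideal_pow I (n : nat) : set A := iter n (ideal_mul I) setT.

Definition integral_closure L : set A :=
  [set x | exists (n : nat) (a : nat -> A),
     [/\ (0 < n)%N,
         forall i : nat, (1 <= i <= n)%N -> ideal_pow L i (a i)
       & x ^+ n + \sum_(1 <= i < n.+1) a i * x ^+ (n - i) = 0]].

Definition strict_filtration F : Prop := forall n : nat, F n.+1 `<` F n.

(* The suprema are taken in [\bar R], so that finiteness can be asserted. *)
Variable R : realType.

Definition asymptotic_resurgence F : \bar R :=
  ereal_sup [set x : \bar R | exists m r : nat,
    [/\ (0 < m)%N, (0 < r)%N,
        (\forall t \near \oo, ~ (F (m * t)%N `<=` ideal_pow (F 1%N) (r * t)%N))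
      & x = (m%:R / r%:R)%:E]].

Definition ic_asymptotic_resurgence F : \bar R :=
  ereal_sup [set x : \bar R | exists m r : nat,
    [/\ (0 < m)%N, (0 < r)%N,
        (\forall t \near \oo,
           ~ (F (m * t)%N `<=` integral_closure (ideal_pow (F 1%N) (r * t)%N)))
      & x = (m%:R / r%:R)%:E]].

Definition ic_resurgence F : \bar R :=
  ereal_sup [set x : \bar R | exists m r : nat,
    [/\ (0 < m)%N, (0 < r)%N,
        ~ (F m `<=` integral_closure (ideal_pow (F 1%N) r))
      & x = (m%:R / r%:R)%:E]].

End Ideals.

Arguments asymptotic_resurgence {A} R F.
Arguments ic_asymptotic_resurgence {A} R F.
Arguments ic_resurgence {A} R F.

Definition covering_matrix (s q : nat) (C : 'M[rat]_(s, q)) : Prop :=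
  (forall i j, 0 <= C i j) /\ (forall j, col j C != 0).

Definition covering_polyhedron (R : realType) (s q : nat) (C : 'M[rat]_(s, q)) :
    set 'rV[R]_s :=
  [set x : 'rV[R]_s | (forall i, 0 <= x 0 i) /\
           (forall j, 1 <= (x *m map_mx ratr C) 0 j)].

(* [@mpolyX s K a] is the monomial t^a. *)
Definition covering_filtration (R : realType) (K : fieldType) (s q : nat)
    (C : 'M[rat]_(s, q)) (n : nat) : set (mpoly s K) :=
  if n is 0 then setT
  else ideal_gen
    [set @mpolyX s K a | a in
       [set a : multinom s |
          covering_polyhedron C (\row_i ((a i)%:R / n%:R : R))]].
Arguments covering_filtration R K {s q} C n.

(* Main.v *)
Require Import Defs.
From mathcomp Require Import all_boot all_order all_algebra.
From mathcomp Require Import boolp classical_sets filter.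
From mathcomp Require Import reals constructive_ereal ereal topology.
From mathcomp Require Import -(notations) mpoly.

(** Write [F n] for the filtration and [I = F 1].

    The ideal [F n] consists of the polynomials all of whose exponents [a]
    satisfy [aC >= n] ([covering_filtrationE]), so [F] is multiplicative and
    ideal membership becomes a question about sums of exponent vectors.

    The two ic-invariants agree because their defining sets have the same
    ratios. If [x] in [F m] is not integral over [I^r], then [x^t], which lies
    in [F (m * t)], is not integral over [I^(r * t)], since an integral equation
    of [x^t] over [I^(r * t)] is one of [x] over [I^r]
    ([integral_closure_root]).

    The asymptotic resurgence dominates the ic-asymptotic one since an ideal
    lies in its integral closure. Conversely, there is a constant [k] such that
    every monomial integral over [I^(n + k)] lies in [I^n]
    ([covering_filtration_briancon_skoda]). If [F (m * t)] is not contained in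
    [I^(r * t)] for large [t], it is therefore not contained in the integral
    closure of [I^(r * t + k)], and the ratios [(m * t) / (r * t + k)] tend to
    [m / r] ([asymptotic_resurgence_le]).

    The constant [k] comes from a pigeonhole argument with remainders. A
    monomial [t^a] is integral over [I^N] exactly when some multiple [i * a],
    [i > 0], dominates a sum of [N * i] exponents of [I], and these can be taken
    in a finite set [B] of generators. Dividing the multiplicity of each
    generator by [i] exhibits below [a] a sum of generators with at least
    [N - size B] terms ([sums_above_root]).

    Finiteness: for [m >= M * r], with [M] large compared to the column sums of
    [C], an exponent [a] of [F m] dominates [r] copies of [floor (a / r)], which
    is an exponent of [I] ([covering_exponents_sums]); so every ratio is below
    [M]. Some ratio exists because strictness makes [I] proper and nonzero. *)

Set Implicit Arguments.
Unset Strict Implicit.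
Unset Printing Implicit Defensive.

Import Order.TTheory GRing.Theory Num.Theory.

Local Open Scope classical_set_scope.
Local Open Scope ring_scope.

(** * Powers of ideals and integral closure *)

Section IdealPowers.
Variable A : comNzRingType.
Implicit Types (I J L G : set A) (m n t i : nat) (x y : A).

Lemma ideal_gen_is_ideal G : is_ideal (ideal_gen G).
Proof.
split=> [I [[] //]|x y Gx Gy I [II GI]|a x Gx I [II GI]].
- by case: (II) => _ + _; apply; [apply: Gx | apply: Gy].
- by case: (II) => _ _; apply; apply: Gx.
Qed.

Lemma mem_ideal_gen G : G `<=` ideal_gen G.
Proof. by move=> x Gx I [_]; apply. Qed.

Lemma ideal_gen_sub G I : is_ideal I -> G `<=` I -> ideal_gen G `<=` I.
Proof. by move=> II GI x; apply. Qed.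

Lemma mem_ideal_mul I J x y : I x -> J y -> ideal_mul I J (x * y).
Proof. by move=> Ix Jy; apply: mem_ideal_gen; exists x => //; exists y. Qed.

Lemma ideal_mul_sub I J L : is_ideal L ->
  (forall x y, I x -> J y -> L (x * y)) -> ideal_mul I J `<=` L.
Proof.
move=> IL IJL; apply: ideal_gen_sub => // _ [x Ix [y Jy <-]]; exact: IJL.
Qed.

(** Lets inclusions out of a product of ideals be checked on generators even
    when the target condition is membership of a multiple [a * x]. *)
Lemma is_ideal_colon I a : is_ideal I -> is_ideal [set x | I (a * x)].
Proof.
move=> [I0 ID IM]; split=> [|x y|b x] /=; first by rewrite mulr0.
  by rewrite mulrDr; apply: ID.
by rewrite mulrCA; apply: IM.
Qed.

Lemma ideal_pow_is_ideal I n : is_ideal (ideal_pow I n).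
Proof. by case: n => [|n]; [split | apply: ideal_gen_is_ideal]. Qed.

Lemma ideal_powM I m n x y :
  ideal_pow I m x -> ideal_pow I n y -> ideal_pow I (m + n) (x * y).
Proof.
move=> + Iy; elim: m x => [x _|m IH x Ix].
  by case: (ideal_pow_is_ideal I n) => _ _; apply.
rewrite mulrC; move: x Ix.
apply: (ideal_mul_sub (L := [set x | ideal_pow I (m.+1 + n) (y * x)])).
  by apply: is_ideal_colon; apply: ideal_pow_is_ideal.
move=> u v Iu Iv /=; rewrite mulrC -mulrA.
by apply: mem_ideal_mul; last exact: IH.
Qed.

(** Together with [ideal_powM] this gives the power laws for ideals that are
    only known through generators, without associativity of [ideal_mul]. *)
Lemma ideal_powD_sub I m n :
  ideal_pow I (m + n) `<=` ideal_mul (ideal_pow I m) (ideal_pow I n).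
Proof.
elim: m => [|m IH].
  by move=> x Ix; rewrite -[x]mul1r; apply: mem_ideal_mul.
apply: ideal_mul_sub; first exact: ideal_gen_is_ideal.
move=> u v Iu /IH.
apply: (ideal_mul_sub
  (L := [set w | ideal_mul (ideal_pow I m.+1) (ideal_pow I n) (u * w)])).
  by apply: is_ideal_colon; apply: ideal_gen_is_ideal.
by move=> x y Ix Iy; rewrite /= mulrA; do 2![apply: mem_ideal_mul => //].
Qed.

Lemma ideal_pow_pow I m n :
  ideal_pow (ideal_pow I m) n = ideal_pow I (m * n).
Proof.
apply/seteqP; split; elim: n => [|n IH]; rewrite ?muln0 //.
  rewrite mulnS; apply: ideal_mul_sub; first exact: ideal_pow_is_ideal.
  by move=> x y Ix /IH; apply: ideal_powM.
rewrite mulnS => x /ideal_powD_sub; move: x; apply: ideal_mul_sub.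
  exact: ideal_gen_is_ideal.
by move=> x y Ix /IH; apply: mem_ideal_mul.
Qed.

Lemma sub_integral_closure I : is_ideal I -> I `<=` integral_closure I.
Proof.
case=> _ _ IM x Ix; exists 1%N, (fun=> - x); split=> // [[|[|]]//= _|].
  rewrite -[- x]mulr1; apply: mem_ideal_mul => //.
  by rewrite -mulN1r; apply: IM.
by rewrite big_nat1 expr0 mulr1 expr1 subrr.
Qed.

(** An equation of degree [n] for [x ^+ t] is an equation of degree [n * t] for
    [x], and its coefficients have the required orders since
    [(I^(r * t))^i = (I^r)^(t * i)]. *)
Lemma integral_closure_root I r t x : (0 < t)%N ->
  integral_closure (ideal_pow I (r * t)) (x ^+ t) ->
  integral_closure (ideal_pow I r) x.
Proof.
move=> t0 [n [a [n0 aI eq0]]].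
(* The coefficients not indexed by a multiple of [t] vanish. *)
exists (n * t)%N, (fun j => if (t %| j)%N then a (j %/ t)%N else 0).
split; first by rewrite muln_gt0 n0.
  move=> j /andP[j1 jn]; case: ifP => [tj|_]; last first.
    by case: (ideal_pow_is_ideal (ideal_pow I r) j).
  have := aI (j %/ t)%N; rewrite !ideal_pow_pow -mulnA [(t * _)%N]mulnC.
  rewrite divnK //; apply; rewrite divn_gt0 // dvdn_leq //=.
  by rewrite leq_divLR.
rewrite mulnC exprM -[RHS]eq0; congr (_ + _).
have -> : \sum_(1 <= i < n.+1) a i * x ^+ t ^+ (n - i) =
  \sum_(1 <= i < n.+1) (fun j => (if (t %| j)%N then a (j %/ t)%N else 0)
      * x ^+ (t * n - j)) (t * i)%N.
  apply: eq_bigr => i _ /=.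
  by rewrite dvdn_mulr // mulKn // -mulnBr exprM.
rewrite (bigID (fun j => t %| j)%N) /= [X in _ + X]big1 ?addr0; last first.
  by move=> j /negbTE ->; rewrite mul0r.
rewrite -big_filter.
suff multiplesE : perm_eq [seq j <- index_iota 1 (t * n).+1 | (t %| j)%N]
    [seq (t * i)%N | i <- index_iota 1 n.+1].
  by rewrite (perm_big _ multiplesE) big_map.
apply: uniq_perm; first by rewrite filter_uniq ?iota_uniq.
  rewrite map_inj_in_uniq ?iota_uniq // => i j _ _ /eqP.
  by rewrite eqn_pmul2l // => /eqP.
move=> j; rewrite mem_filter mem_index_iota; apply/andP/mapP.
  case=> /dvdnP[i ->]; rewrite mulnC muln_gt0 ltnS leq_pmul2l // t0 => i1n.
  by exists i; rewrite ?mem_index_iota.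
case=> i; rewrite mem_index_iota ltnS => /andP[i0 i_n] ->.
by rewrite dvdn_mulr // muln_gt0 t0 i0 ltnS leq_pmul2l.
Qed.

End IdealPowers.

(** * Comparison of the resurgences of a filtration *)

Section Resurgence.
Variables (R : realType) (A : comNzRingType) (F : nat -> set A).

(** Multiplying [m] and [r] by [t] preserves both the ratio and, by
    [integral_closure_root], the failure of the containment; so the suprema are
    over the same set. *)
Lemma ic_asymptotic_resurgenceE :
  (forall m t x, F m x -> F (m * t)%N (x ^+ t)) ->
  ic_asymptotic_resurgence R F = ic_resurgence R F.
Proof.
move=> FX; congr ereal_sup; apply/seteqP; split=> _ [m [r [m0 r0 + ->]]].
  move=> [t0 _ /(_ t0.+1 (leqnSn _))]; exists (m * t0.+1)%N, (r * t0.+1)%N.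
  split; rewrite ?muln_gt0 ?m0 ?r0 //.
  by rewrite !natrM -mulf_div divff ?mulr1 // pnatr_eq0.
move=> nFI; exists m, r; split=> //; exists 1%N => // t /= t0 FI.
by apply: nFI => x /FX/FI; apply: integral_closure_root.
Qed.

Lemma ic_asymptotic_resurgence_le :
  (ic_asymptotic_resurgence R F <= asymptotic_resurgence R F)%E.
Proof.
apply: ereal_sup_le => _ [m [r [m0 r0 nFI ->]]]; exists m, r; split=> //.
apply: filterS nFI => t nFI FI; apply: nFI => x /FI.
by apply: sub_integral_closure; apply: ideal_pow_is_ideal.
Qed.

(** A failure of [F (m * t)] to lie in [I^(r * t)] for all large [t] yields the
    ratios [(m * t) / (r * t + k)] in the ic-resurgence set, and these converge
    to [m / r]. *)
Lemma asymptotic_resurgence_le k :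
  (forall m n, F m `<=` integral_closure (ideal_pow (F 1%N) (n + k)) ->
     F m `<=` ideal_pow (F 1%N) n) ->
  (asymptotic_resurgence R F <= ic_resurgence R F)%E.
Proof.
move=> BS; apply: ge_ereal_sup => _ [m [r [m0 r0 [t0 _ nFI] ->]]].
have ub t : (t0 < t)%N ->
    (((m * t)%:R / (r * t + k)%:R : R)%:E <= ic_resurgence R F)%E.
  move=> t0t; apply: ereal_sup_ubound; exists (m * t)%N, (r * t + k)%N.
  have t_gt0 : (0 < t)%N by apply: leq_ltn_trans t0t.
  split; rewrite ?addn_gt0 ?muln_gt0 ?m0 ?r0 ?t_gt0 // => /BS.
  exact/nFI/ltnW.
case: (ic_resurgence R F) ub => [y| |] ub; last 2 first.
- by rewrite leey.
- by have := ub _ (ltnSn t0).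
rewrite lee_fin leNgt ltr_pdivlMr ?ltr0n //; apply/negP => ltym.
have d_gt0 : 0 < m%:R - y * r%:R by rewrite subr_gt0.
(* [(m * t) / (r * t + k) <= y] means [t * (m - y * r) <= y * k], which fails
   for large [t]. *)
pose N := Num.bound (`|y * k%:R| / (m%:R - y * r%:R)).
have : `|y * k%:R| / (m%:R - y * r%:R) < N%:R.
  by apply: archi_boundP; rewrite divr_ge0 // ltW.
rewrite ltr_pdivrMr // => ltN.
have [t t0t tN] : exists2 t, (t0 < t)%N & N%:R <= t%:R :> R.
  by exists (N + t0).+1; rewrite ?ltnS ?leq_addl // ler_nat leqW // leq_addr.
have := ub _ t0t.
rewrite lee_fin ler_pdivrMr; last first.
  by rewrite ltr0n addn_gt0 muln_gt0 r0 (leq_ltn_trans _ t0t).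
rewrite natrD !natrM leNgt => /negP; apply.
rewrite mulrDr mulrA -ltrBrDl -mulrBl; apply: le_lt_trans (ler_norm _) _.
by apply: lt_le_trans ltN _; rewrite mulrC ler_pM2l.
Qed.

(** The containments bound all ratios by [b]; a single failing containment
    keeps the supremum away from [-oo]. *)
Lemma ic_resurgence_fin_num (b : nat) :
  (forall m r, (0 < r)%N -> (b * r <= m)%N -> F m `<=` ideal_pow (F 1%N) r) ->
  (exists m r, [/\ (0 < m)%N, (0 < r)%N
    & ~ F m `<=` integral_closure (ideal_pow (F 1%N) r)]) ->
  ic_resurgence R F \is a fin_num.
Proof.
move=> Fb [m [r [m_gt0 r_gt0 nFI]]].
rewrite fin_numElt; apply/andP; split.
  apply: lt_le_trans (ltNyr (m%:R / r%:R)) _.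
  by apply: ereal_sup_ubound; exists m, r.
apply: le_lt_trans (ltry b%:R); apply: ge_ereal_sup.
move=> _ [m' [r' [m'0 r'0 nFI' ->]]].
rewrite lee_fin ler_pdivrMr ?ltr0n // -natrM ler_nat leqNgt.
apply/negP => /ltnW lebm; apply: nFI' => x /(Fb _ _ r'0 lebm).
by apply: sub_integral_closure; apply: ideal_pow_is_ideal.
Qed.

End Resurgence.

(** * Monomial ideals *)

Section MonomialIdeals.
Variables (s : nat) (K : fieldType).
Implicit Types (U : set (multinom s)) (a b : multinom s).
Implicit Types (l B : seq (multinom s)).
Implicit Types (n i : nat) (p : mpoly s K).

Definition upper_set U :=
  forall a b, U a -> (forall j, (a j <= b j)%N) -> U b.

(** For an upper set [U] this is the monomial ideal spanned by the monomials
    with exponent in [U]. *)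
Definition supported_in U : set (mpoly s K) :=
  [set p | forall a, a \in msupp p -> U a].

(** The exponents of the [n]-th power of a monomial ideal with exponents [U].
    Domination, rather than equality, of the sum makes this an upper set also
    for [n = 0]. *)
Definition sums_above U n : set (multinom s) :=
  [set a | exists l, [/\ size l = n, (forall b, b \in l -> U b)
             & forall j, (\sum_(b <- l) b j <= a j)%N]].

Lemma supported_in_monomial U a : supported_in U (mpolyX K a) <-> U a.
Proof.
split=> [|Ua b]; first by apply; rewrite msuppX mem_head.
by rewrite msuppX inE => /eqP ->.
Qed.

Lemma supported_inM U V W p q :
  (forall a b, U a -> V b -> W (mnm_add a b)) ->
  supported_in U p -> supported_in V q -> supported_in W (p * q).
Proof.
move=> UVW Up Vq c /msuppM_le /allpairsP[[a b] /= [ap bq ->]].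
by apply: UVW; [apply: Up | apply: Vq].
Qed.

Lemma supported_in_is_ideal U : upper_set U -> is_ideal (supported_in U).
Proof.
move=> upU; split=> [a|p q Up Uq a|p q Uq].
- by rewrite mcoeff_msupp mcoeff0 eqxx.
- by move/msuppD_le; rewrite mem_cat => /orP[/Up|/Uq].
apply: (@supported_inM setT U) Uq => // a b _ Ub.
by apply: upU Ub _ => j; rewrite mnmDE leq_addl.
Qed.

Lemma supported_in_sub U (I : set (mpoly s K)) : is_ideal I ->
  (forall a, U a -> I (mpolyX K a)) -> supported_in U `<=` I.
Proof.
move=> [I0 ID IM] UI p Up; rewrite (mpolyE p) big_seq.
apply: big_ind => // a /Up Ua.
by rewrite -mul_mpolyC; apply/IM/UI.
Qed.

Lemma monomial_ideal_supported_in U : upper_set U ->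
  ideal_gen [set mpolyX K a | a in U] = supported_in U.
Proof.
move=> upU; apply/seteqP; split.
  apply: ideal_gen_sub; first exact: supported_in_is_ideal.
  by move=> _ [a Ua <-]; apply/supported_in_monomial.
apply: supported_in_sub; first exact: ideal_gen_is_ideal.
by move=> a Ua; apply: mem_ideal_gen; exists a.
Qed.

Lemma sums_above_upper U n : upper_set (sums_above U n).
Proof.
move=> a b [l [sz lU la]] ab; exists l; split=> // j.
exact: leq_trans (la j) (ab j).
Qed.

Lemma ideal_pow_supported_in U n : upper_set U ->
  ideal_pow (supported_in U) n = supported_in (sums_above U n).
Proof.
move=> upU; apply/seteqP; split.
  elim: n => [|n IH].
    by move=> p _ a _; exists [::]; split=> // j; rewrite big_nil.
  apply: ideal_mul_sub.
    exact/supported_in_is_ideal/sums_above_upper.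
  move=> p q Up /IH; apply: supported_inM Up => a b Ua [l [sz lU lb]].
  exists (a :: l); split=> [|c|j]; first by rewrite /= sz.
    by rewrite inE => /orP[/eqP ->|/lU].
  by rewrite big_cons mnmDE leq_add2l.
apply: supported_in_sub; first exact: ideal_pow_is_ideal.
move=> a [l [<- ]]; elim: l a => [|b l IH] a lU la //=.
have ba j : (b j <= a j)%N.
  by apply: leq_trans (la j); rewrite big_cons leq_addr.
have -> : a = mnm_add b (mnm_sub a b).
  by apply/mnmP => j; rewrite mnmDE mnmBE subnKC.
rewrite mpolyXD; apply: mem_ideal_mul.
  by apply/supported_in_monomial/lU; rewrite mem_head.
apply: IH => [c cl|j]; first by apply: lU; rewrite inE cl orbT.
by rewrite mnmBE leq_subRL //; have := la j; rewrite big_cons.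
Qed.

(** The coefficient of [t^(d * a)] in an integral equation of degree [d] of
    [t^a] must cancel, so some coefficient [c i] of the equation contains the
    monomial [t^(i * a)], and [c i] lies in a power of the ideal. *)
Lemma integral_monomial U n a : upper_set U ->
  integral_closure (ideal_pow (supported_in U) n) (mpolyX K a) ->
  exists2 i, (0 < i)%N & sums_above U (n * i) (mnm_muln a i).
Proof.
move=> upU [d [c [d0 cI eq0]]].
have : mcoeff (mnm_muln a d)
    (\sum_(1 <= i < d.+1) c i * mpolyX K a ^+ (d - i)) != 0.
  move/eqP: eq0; rewrite addrC addr_eq0 => /eqP ->.
  by rewrite mpolyXn mcoeffN mcoeffX eqxx oppr_eq0 oner_eq0.
rewrite raddf_sum /= => nz.
have [i i1d nzi] : exists2 i, (1 <= i <= d)%N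
    & mcoeff (mnm_muln a d) (c i * mpolyX K a ^+ (d - i)) != 0.
  apply: contrapT => /forall2NP none; case/eqP: nz.
  rewrite big_nat big1 // => i i1d; apply: contrapT => /eqP nzi.
  by case: (none i); rewrite ?i1d ?nzi.
exists i; first by case/andP: i1d.
move: nzi; rewrite -mcoeff_msupp mpolyXn => /msuppM_le /allpairsP[[b b'] /=].
rewrite msuppX inE => -[bc /eqP -> adE].
have -> : mnm_muln a i = b.
  apply/mnmP => j; have /mnmP/(_ j) := adE.
  case/andP: i1d => _ i_d; rewrite mnmDE !mulmnE => /eqP.
  by rewrite -{1}(subnK i_d) mulnDr addnC eqn_add2r => /eqP.
by have := cI i i1d; rewrite ideal_pow_pow ideal_pow_supported_in //; apply.
Qed.

Lemma sum_count l (f : multinom s -> nat) :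
  (\sum_(b <- l) f b = \sum_(b <- undup l) count_mem b l * f b)%N.
Proof.
rewrite -big_undup_iterop_count; apply: eq_bigr => b _.
by rewrite Monoid.iteropE iter_addn_0 mulnC.
Qed.

(** Replace the [(n + size B) * i] summands below [i * a] by elements of [B] and
    divide the multiplicity of each by [i]: the quotients give a sum below [a],
    and rounding loses fewer than [i] summands per element of [B], hence at most
    [size B] summands after the division. *)
Lemma sums_above_root U B n i a : (forall b, b \in B -> U b) ->
  (forall c, U c -> exists2 b, b \in B & forall j, (b j <= c j)%N) ->
  (0 < i)%N -> sums_above U ((n + size B) * i) (mnm_muln a i) ->
  sums_above U n a.
Proof.
move=> BU Bmin i0 [l0 [sz0 l0U l0a]].
have [l [sz lB la]] : exists l, [/\ size l = size l0, {subset l <= B}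
    & forall j, (\sum_(b <- l) b j <= \sum_(b <- l0) b j)%N].
  elim: l0 {sz0 l0a} l0U => [|c l0 IH] l0U.
    by exists [::]; split=> // j; rewrite !big_nil.
  have [b cl|l [sz lB ll0]] := IH; first by apply: l0U; rewrite inE cl orbT.
  have [b bB bc] := Bmin c (l0U c (mem_head _ _)).
  exists (b :: l); split=> [|d|j]; first by rewrite /= sz.
    by rewrite inE => /orP[/eqP ->|/lB].
  by rewrite !big_cons leq_add.
pose l' := flatten [seq nseq (count_mem b l %/ i) b | b <- undup l].
have sum_l' f : (\sum_(b <- l') f b =
    \sum_(b <- undup l) count_mem b l %/ i * f b)%N.
  rewrite big_flatten big_map; apply: eq_bigr => b _.
  by rewrite big_nseq iter_addn_0 mulnC.
have n_l' : (n <= size l')%N.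
  have szu : (size (undup l) <= size B)%N.
    apply: uniq_leq_size; first exact: undup_uniq.
    by move=> b; rewrite mem_undup => /lB.
  rewrite -(leq_add2r (size B)) -(leq_pmul2r i0) -sz0 -sz.
  apply: leq_trans (leq_mul (leq_add (leqnn _) szu) (leqnn i)).
  rewrite -!sum1_size sum_count sum_l' mulnDl !big_distrl -big_split /=.
  apply: leq_sum => b _; rewrite !muln1 mul1n {1}(divn_eq (count_mem b l) i).
  by rewrite leq_add2l ltnW ?ltn_mod.
exists (take n l'); split=> [|b /mem_take|j]; first by rewrite size_takel.
  case/flattenP => _ /mapP[c cl ->]; rewrite mem_nseq => /andP[_ /eqP ->].
  by apply/BU/lB; rewrite -mem_undup.
apply: (@leq_trans (\sum_(b <- l') b j)).
  by rewrite -{2}(cat_take_drop n l') big_cat leq_addr.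
rewrite -(leq_pmul2r i0) -mulmnE; apply: leq_trans (l0a j).
apply: leq_trans (la j).
rewrite sum_l' sum_count big_distrl; apply: leq_sum => b _ /=.
by rewrite mulnAC leq_mul // leq_divM.
Qed.

End MonomialIdeals.

(** * Covering polyhedra and their filtrations *)

Section CoveringExponents.
Variables (s q : nat) (C : 'M[rat]_(s, q)).
Implicit Types (a b : multinom s) (n : nat).

Definition covering_exponents n : set (multinom s) :=
  [set a | forall j, n%:R <= \sum_i (a i)%:R * C i j].

Lemma covering_polyhedron_exponents (R : realType) n a : (0 < n)%N ->
  covering_polyhedron C (\row_i ((a i)%:R / n%:R : R)) <->
  covering_exponents n a.
Proof.
move=> n0; have coordE j : ((\row_i ((a i)%:R / n%:R : R)) *m map_mx ratr C) 0 j
    = ratr (\sum_i (a i)%:R * C i j) / n%:R.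
  rewrite mxE rmorph_sum mulr_suml; apply: eq_bigr => i _.
  by rewrite !mxE rmorphM /= ratr_nat mulrAC.
have ge1E j : (1 <= ((\row_i ((a i)%:R / n%:R : R)) *m map_mx ratr C) 0 j)
    = (n%:R <= \sum_i (a i)%:R * C i j).
  by rewrite coordE ler_pdivlMr ?ltr0n // mul1r -(ratr_nat R n) ler_rat.
split=> [[_ aC] j|aC]; first by rewrite -ge1E.
split=> [i|j]; last by rewrite ge1E.
by rewrite mxE divr_ge0.
Qed.

Hypothesis C_ge0 : forall i j, 0 <= C i j.

Lemma covering_exponents_upper n : upper_set (covering_exponents n).
Proof.
move=> a b aC ab j; apply: le_trans (aC j) _.
by apply: ler_sum => i _; rewrite ler_wpM2r // ler_nat.
Qed.

Lemma covering_exponentsD m n a b : covering_exponents m a ->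
  covering_exponents n b -> covering_exponents (m + n) (mnm_add a b).
Proof.
move=> aC bC j; rewrite natrD; apply: le_trans (lerD (aC j) (bC j)) _.
rewrite -big_split /= le_eqVlt; apply/orP; left; apply/eqP.
by apply: eq_bigr => i _; rewrite mnmDE natrD mulrDl.
Qed.

(** Truncating the coordinates of [a] at [M], where [M * C i j >= 1] for all
    nonzero entries of [C], preserves each inequality [(aC)_j >= 1]: either a
    coordinate that counts in column [j] is truncated, and alone contributes at
    least [1], or the left-hand side is unchanged. So the exponents in the box
    [[0, M]^s] generate. *)
Lemma covering_exponents1_basis :
  exists B : seq (multinom s), (forall b, b \in B -> covering_exponents 1 b) /\
    forall a, covering_exponents 1 a ->
      exists2 b, b \in B & forall i, (b i <= a i)%N.
Proof.
pose M := \max_(ij : 'I_s * 'I_q) Num.bound (C ij.1 ij.2)^-1.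
have M_ge i j : 0 < C i j -> 1 <= M%:R * C i j.
  move=> Cij; rewrite -ler_pdivrMr // mul1r; apply/ltW.
  apply: lt_le_trans (archi_boundP _) _; first by rewrite invr_ge0.
  by rewrite ler_nat /M (leq_bigmax (i, j)).
pose box_point (f : {ffun 'I_s -> 'I_M.+1}) : multinom s :=
  Multinom [tuple (f i : nat) | i < s].
pose box := [seq box_point f | f : {ffun 'I_s -> 'I_M.+1}].
exists [seq b <- box | `[< covering_exponents 1 b >]].
split=> [b|a aC]; first by rewrite mem_filter => /andP[/asboolP].
pose b := box_point [ffun i => inord (minn (a i) M)].
have bE i : b i = minn (a i) M.
  by rewrite /b /box_point mnmE ffunE inordK // ltnS geq_minr.
exists b; last by move=> i; rewrite bE geq_minl.
rewrite mem_filter map_f ?mem_enum // andbT; apply/asboolP => j.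
have [[i /andP[Cij Mai]]|none] :=
  pselect (exists i, (0 < C i j) && (M < a i)%N).
  apply: le_trans (M_ge i j Cij) _; rewrite (bigD1 i) //= bE.
  rewrite (minn_idPr (ltnW Mai)) lerDl sumr_ge0 // => k _.
  by rewrite mulr_ge0.
apply: le_trans (aC j) _; apply: ler_sum => i _; rewrite bE.
have := C_ge0 i j; rewrite le_eqVlt => /orP[/eqP <-|Cij].
  by rewrite !mulr0.
rewrite ler_wpM2r // ler_nat leq_min leqnn /= leqNgt; apply/negP => Mai.
by apply: none; exists i; rewrite Cij.
Qed.

(** With [b = floor (a / r)] one has [a <= r * b + r], so
    [r * (bC)_j >= m - r * S] where [S] bounds the column sums of [C]; hence [b]
    is an exponent of the first ideal as soon as [m >= r * (S + 1)]. *)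
Lemma covering_exponents_sums : exists M : nat, forall m r,
  (0 < r)%N -> (M * r <= m)%N ->
  covering_exponents m `<=` sums_above (covering_exponents 1) r.
Proof.
pose S := \sum_j \sum_i C i j.
exists (Num.bound S).+1 => m r r0 Mrm a aC.
pose b : multinom s := Multinom [tuple (a i %/ r)%N | i < s].
have bE i : b i = (a i %/ r)%N by rewrite mnmE.
exists (nseq r b); split=> [|c|i]; first exact: size_nseq; last first.
  by rewrite big_nseq iter_addn_0 bE leq_divM.
rewrite mem_nseq => /andP[_ /eqP ->] j.
have rR : 0 < r%:R :> rat by rewrite ltr0n.
have colS : \sum_i C i j <= S.
  rewrite /S [leRHS](bigD1 j) //= lerDl sumr_ge0 // => k _.
  by rewrite sumr_ge0.
have ltS : S < (Num.bound S)%:R.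
  by apply: archi_boundP; do 2![apply: sumr_ge0 => ? _].
rewrite -(ler_pM2r rR) mul1r.
have : m%:R <= (\sum_i (b i)%:R * C i j) * r%:R + r%:R * \sum_i C i j.
  apply: le_trans (aC j) _; rewrite mulr_suml mulr_sumr -big_split /=.
  apply: ler_sum => i _; rewrite mulrAC -mulrDl ler_wpM2r //.
  rewrite -natrM -natrD ler_nat bE {1}(divn_eq (a i) r) leq_add2l.
  by rewrite ltnW // ltn_mod.
have : ((Num.bound S).+1 * r)%:R <= m%:R :> rat by rewrite ler_nat.
have : r%:R * \sum_i C i j <= r%:R * (Num.bound S)%:R.
  by rewrite ler_pM2l // ltW // (le_lt_trans colS).
rewrite natrM -natr1 mulrDl mul1r [_ * r%:R]mulrC.
move=> h1 h2 h3; have := le_trans h2 h3.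
rewrite addrC -lerBrDr => /le_trans; apply.
by rewrite -addrA gerDl subr_le0.
Qed.

End CoveringExponents.

Section CoveringFiltration.
Variables (R : realType) (K : fieldType) (s q : nat) (C : 'M[rat]_(s, q)).
Hypothesis C_ge0 : forall i j, 0 <= C i j.
Local Notation F := (covering_filtration R K C).
Local Notation E := (covering_exponents C).

Lemma covering_filtrationE n : F n = supported_in (E n).
Proof.
case: n => [|n].
  apply/seteqP; split=> // p _ a _ j.
  by rewrite sumr_ge0 // => i _; rewrite mulr_ge0.
rewrite /= -monomial_ideal_supported_in; last exact: covering_exponents_upper.
congr (ideal_gen [set _ | _ in _]); apply/seteqP.
by split=> a /= /covering_polyhedron_exponents; apply.
Qed.

Lemma covering_filtration_exp m t p : F m p -> F (m * t)%N (p ^+ t).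
Proof.
move=> Fp; elim: t => [|t IH]; first by rewrite muln0.
rewrite exprS mulnS; move: Fp IH; rewrite !covering_filtrationE.
by apply: supported_inM => a b; apply: covering_exponentsD.
Qed.

(** A linear, monomial form of the theorem of Briancon and Skoda: integral
    dependence costs only a bounded loss in the exponent. *)
Lemma covering_filtration_briancon_skoda : exists k, forall n a,
  integral_closure (ideal_pow (F 1%N) (n + k)) (mpolyX K a) ->
  sums_above (E 1) n a.
Proof.
have [B [BE Bmin]] := covering_exponents1_basis C_ge0.
exists (size B) => n a; rewrite covering_filtrationE.
move=> /(integral_monomial (covering_exponents_upper C_ge0 (n := 1)))[i i0].
exact: sums_above_root.
Qed.

(** Strictness provides a monomial [t^a] in [I = F 1] and shows that nonzero
    degree is needed for membership in [I]. Were [t^a] integral over a power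
    [I^(deg a + 1 + k)], then [a] would dominate a sum of
    [deg a + 1] nonzero exponents. *)
Lemma covering_filtration_not_sub : strict_filtration F -> exists m r,
  [/\ (0 < m)%N, (0 < r)%N &
      ~ F m `<=` integral_closure (ideal_pow (F 1%N) r)].
Proof.
move=> strictF; have [k BS] := covering_filtration_briancon_skoda.
have [a Ea] : exists a, E 1 a.
  apply: contrapT => noE; have [_ ] := strictF 1%N; apply=> p.
  rewrite !covering_filtrationE => Fp a ap.
  by case: noE; exists a; apply: Fp.
have E1_gt0 b : E 1 b -> (0 < mdeg b)%N.
  rewrite lt0n mdeg_eq0 => Eb; apply/eqP => b0; have [_] := strictF 0%N; apply.
  move=> p _; rewrite covering_filtrationE => c _.
  by apply: covering_exponents_upper Eb _ => // i; rewrite b0 mnm0E.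
exists 1%N, ((mdeg a).+1 + k)%N; split=> // F1I.
have [|l [sz lE la]] := BS (mdeg a).+1 a.
  by apply: F1I; rewrite covering_filtrationE; apply/supported_in_monomial.
suff : (size l <= mdeg a)%N by rewrite sz ltnn.
rewrite mdegE -sum1_size.
apply: (@leq_trans (\sum_(b <- l) mdeg b)).
  by rewrite !big_seq; apply: leq_sum => b /lE /E1_gt0.
rewrite (eq_bigr (fun b : multinom s => \sum_i b i)%N); last first.
  by move=> b _; exact: mdegE.
by rewrite exchange_big; apply: leq_sum => i _.
Qed.

End CoveringFiltration.

Theorem lemma5p2 (R : realType) (K : fieldType) (s q : nat)
    (C : 'M[rat]_(s, q)) (hC : covering_matrix C)
    (hstrict : strict_filtration (covering_filtration R K C)) :
  [/\ asymptotic_resurgence R (covering_filtration R K C) =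
        ic_asymptotic_resurgence R (covering_filtration R K C),
      ic_asymptotic_resurgence R (covering_filtration R K C) =
        ic_resurgence R (covering_filtration R K C)
    & ic_resurgence R (covering_filtration R K C) \is a fin_num].
Proof.
have C_ge0 : forall i j, 0 <= C i j by case: hC.
have FE := covering_filtrationE R K C_ge0.
have E_upper := covering_exponents_upper C_ge0.
have ic_eq := ic_asymptotic_resurgenceE R
  (@covering_filtration_exp R K s q C C_ge0).
split=> //.
  apply/eqP; rewrite eq_le ic_asymptotic_resurgence_le andbT ic_eq.
  have [k BS] := covering_filtration_briancon_skoda R K C_ge0.
  apply: (@asymptotic_resurgence_le R _ _ k) => m n.
  rewrite [X in X `<=` _](FE m) => Fic; rewrite !FE ideal_pow_supported_in //.
  move=> p Fp a /Fp Ea; apply: BS; apply: Fic.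
  exact/supported_in_monomial.
have [b FI] := covering_exponents_sums C_ge0.
apply: (@ic_resurgence_fin_num R _ _ b); last first.
  exact: covering_filtration_not_sub.
move=> m r r0 brm; rewrite !FE ideal_pow_supported_in // => p Fp a /Fp.
exact: FI.
Qed.
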